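(* Let $\{F^{(n)}\}_{n\ge 2}$ be a uniformly pattern-generated family, with integer $n_0$, fixed patterns $(\mathbf r^{(1)},\mathbf h^{(1)}),\dots,(\mathbf r^{(M)},\mathbf h^{(M)})$ and polynomial $\Psi\in\mathbb{Q}[z_1,\dots,z_M]$ as in the definition of uniform pattern generation. Define $$a(n)=F^{(n)}(\alpha_{1,n},\dots,\alpha_{n-1,n}).$$ Then there exist an integer $n_1$ and a polynomial $R_\infty(n)\in\mathbb{Q}[n]$ such that $a(n)=R_\infty(n)$ for every $n\ge n_1$ satisfying $$\gcd\Bigl(n,\prod_{m=1}^M\prod_j r_j^{(m)}\Bigr)=1.$$
   Context: A pattern $(\mathbf r,\mathbf h)$ consists of an integer $t\ge 1$, a tuple $\mathbf r=(r_1,\dots,r_t)$ of nonzero integers with $r_1=1$, and a tuple $\mathbf h=(h_1,\dots,h_t)$ of nonnegative integers ($t$ may depend on the pattern). For $n\ge 2$ put $\Omega_n=\{1,\dots,n-1\}$ and $\alpha_{k,n}=\cos(2\pi k/n)$ for $k\in\Omega_n$. For an integer $r$ with $\gcd(r,n)=1$, let $\sigma_r:\Omega_n\to\Omega_n$ be the permutation determined by $\sigma_r(k)\equiv rk\pmod n$. If $\gcd(n,r_1\cdots r_t)=1$, the pattern sum is $$T^{(n)}_{\mathbf r,\mathbf h}(x_1,\dots,x_{n-1})=\sum_{k\in\Omega_n}\prod_{j=1}^t\bigl(2x_{\sigma_{r_j}(k)}\bigr)^{h_j}\in\mathbb{Q}[x_1,\dots,x_{n-1}].$$ A family $\{F^{(n)}\}_{n\ge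 2}$ with $F^{(n)}\in\mathbb{Q}[x_1,\dots,x_{n-1}]$ is uniformly pattern-generated if there exist an integer $n_0$, finitely many fixed patterns $(\mathbf r^{(1)},\mathbf h^{(1)}),\dots,(\mathbf r^{(M)},\mathbf h^{(M)})$, and a single polynomial $\Psi\in\mathbb{Q}[z_1,\dots,z_M]$ such that for every integer $n\ge n_0$ with $\gcd\bigl(n,\prod_{m=1}^M\prod_j r_j^{(m)}\bigr)=1$ one has $$F^{(n)}(x_1,\dots,x_{n-1})=\Psi\Bigl(T^{(n)}_{\mathbf r^{(1)},\mathbf h^{(1)}}(x),\dots,T^{(n)}_{\mathbf r^{(M)},\mathbf h^{(M)}}(x)\Bigr).$$ *)

(* Defs.v *)
From HB Require Import structures.
From mathcomp Require Import all_boot all_order all_algebra.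
From mathcomp Require Import mpoly.
From mathcomp Require Import reals trigo.

Set Implicit Arguments.
Unset Strict Implicit.
Unset Printing Implicit Defensive.

Import Order.TTheory GRing.Theory Num.Theory.

Local Open Scope ring_scope.

(* The length t >= 1 is plen.+1; indices are 0-based, so r_1 is pr ord0. *)
Record pattern := Pattern {
  plen : nat;
  pr : 'I_plen.+1 -> int;
  ph : 'I_plen.+1 -> nat;
  pr_neq0 : forall j, pr j != 0;
  pr_first : pr ord0 = 1 }.

(* Omega_n = {1, ..., n-1} is encoded by 'I_n.-1, the ordinal i standing for
   k = i.+1. When r is not coprime to n, the residue may be 0 and the value is
   then meaningless; see sigmaE for the coprime case. *)
Definition sigma (n : nat) (r : int) (i : 'I_n.-1) : 'I_n.-1 :=
  insubd i `|(r * i.+1%:Z %% n%:Z)%Z|%N.-1.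

Lemma sigmaE (n : nat) (r : int) (i : 'I_n.-1) :
  coprimez r n%:Z -> (sigma r i).+1%:Z = (r * i.+1%:Z %% n%:Z)%Z.
Proof.
move=> co; have lti := ltn_ord i.
have n_gt1 : (1 < n)%N by move: lti; clear; case: n i => [|[|n]] [].
have lti1 : (i.+1 < n)%N by rewrite -ltn_predRL.
have n_neq0 : n%:Z != 0 by rewrite -lt0n ltnW.
have n_gt0 : 0 < n%:Z by rewrite ltz_nat ltnW.
rewrite /sigma.
have := ltz_pmod (r * i.+1%:Z) n_gt0; have := modz_ge0 (r * i.+1%:Z) n_neq0.
case E: (_ %% _)%Z => [[|m]|] // _; last first.
  by rewrite ltz_nat -ltn_predRL => ltm; rewrite val_insubd /= ltm.
have : (n%:Z %| r * i.+1%:Z)%Z by apply/dvdz_mod0P.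
rewrite Gauss_dvdzr 1?coprimez_sym //.
by rewrite /dvdz /= => /(dvdn_leq (ltn0Sn i)); rewrite leqNgt lti1.
Qed.

Definition omega_cos (R : realType) (n : nat) (i : 'I_n.-1) : R :=
  cos (2 * pi * i.+1%:R / n%:R).

Definition pattern_sum (n : nat) (p : pattern) : {mpoly rat[n.-1]} :=
  \sum_(k < n.-1) \prod_(j < (plen p).+1) (2 *: 'X_(sigma (pr j) k)) ^+ ph j.

Definition pattern_coprime (M : nat) (P : 'I_M -> pattern) (n : nat) : bool :=
  coprimez n%:Z (\prod_(m < M) \prod_(j < (plen (P m)).+1) pr j).

(* F is uniformly pattern-generated, with witnesses n0, P and Psi; only the
   members F n with n >= 2 are meaningful. *)
Definition uniformly_pattern_generated_by (F : forall n, {mpoly rat[n.-1]})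
    (n0 : int) (M : nat) (P : 'I_M -> pattern) (Psi : {mpoly rat[M]}) : Prop :=
  forall n : nat, (2 <= n)%N -> n0 <= n%:Z -> pattern_coprime P n ->
    F n = Psi \mPo [tuple pattern_sum n (P m) | m < M].

(* Evaluation at (cos (2 pi k / n))_k, the rational coefficients being
   embedded into R. *)
Definition cos_value (R : realType) (F : forall n, {mpoly rat[n.-1]})
    (n : nat) : R :=
  (map_mpoly ratr (F n)).@[@omega_cos R n].

(* Main.v *)
(* By the product-to-sum formula, the summand of a pattern sum at the cosine
   point is a fixed finite sum of terms cos (m x) at x = 2 pi k / n. Summing
   over a full period kills every frequency m with 0 < |m| < n, so for large n
   each pattern sum is an affine function of n with rational coefficients; Psi
   composed with these functions is the required polynomial. *)

Require Import Defs.
From HB Require Import structures.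
From mathcomp Require Import all_boot all_order all_algebra.
From mathcomp Require Import mpoly.
From mathcomp Require Import reals trigo.
From mathcomp Require Import ring.

Import Order.TTheory GRing.Theory Num.Theory.
Local Open Scope ring_scope.

Lemma coprimez_prodr (I : finType) (G : I -> int) (a : int) (i : I) :
  coprimez a (\prod_j G j) -> coprimez a (G i).
Proof. by rewrite (bigD1 i) //= coprimezMr => /andP[]. Qed.

Lemma pattern_coprimeP (M : nat) (P : 'I_M -> pattern) (n : nat) :
  pattern_coprime P n -> forall m j, coprimez (pr (p := P m) j) n%:Z.
Proof.
move=> co m j; rewrite coprimez_sym.
exact: coprimez_prodr (coprimez_prodr _ _ _ m co).
Qed.

Lemma meval_map_mpoly (n : nat) (A : nzRingType) (S : comNzRingType)
    (f : {rmorphism A -> S}) (v : 'I_n -> S) (p : {mpoly A[n]}) :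
  (map_mpoly f p).@[v] = mmap f v p.
Proof.
rewrite /map_mpoly /mmap raddf_sum; apply: eq_bigr => m _ /=.
by rewrite mevalM mevalC mmap1_id mevalX.
Qed.

(** This lets [Psi] be applied to the values of the pattern sums instead of to the sums as
    polynomials. *)
Lemma mmap_comp_mpoly (k n : nat) (A S : comNzRingType) (f : {rmorphism A -> S})
    (v : 'I_n -> S) (lq : k.-tuple {mpoly A[n]}) (p : {mpoly A[k]}) :
  mmap f v (p \mPo lq) = mmap f (fun i => mmap f v (tnth lq i)) p.
Proof.
rewrite comp_mpolyE raddf_sum; apply: eq_bigr => m _.
rewrite /= mmapZ rmorph_prod; congr (_ * _).
by apply: eq_bigr => i _; rewrite rmorphXn.
Qed.

Section Cos.
Context {R : realType}.
Implicit Type x : R.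

Lemma cos_add_2piz x (m : int) : cos (x + 2 * pi * m%:~R) = cos x.
Proof.
have Hn (k : nat) y : cos (y + 2 * pi * k%:R) = cos y :> R.
  by rewrite mulr_natr mulr_natl (periodicn (@cosD2pi R)).
case: m => k; first exact: Hn.
by rewrite NegzE mulrNz mulrN -[LHS](Hn k.+1) subrK.
Qed.

(** Induction with 2 cos a cos b = cos (a + b) + cos (a - b). As [l] is chosen before [x], the same
    frequencies serve every n. *)
Lemma prod_cos_linearize (s : seq int) : exists l : seq int, forall x,
  \prod_(r <- s) (2 * cos (r%:~R * x)) = \sum_(m <- l) cos (m%:~R * x).
Proof.
elim: s => [|r s [l IH]].
  by exists [:: 0] => x; rewrite big_nil big_seq1 mul0r cos0.
exists ([seq m + r | m <- l] ++ [seq m - r | m <- l]) => x.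
rewrite big_cons IH big_cat !big_map /= -big_split mulr_sumr /=.
apply: eq_bigr => m _.
by rewrite intrB intrD mulrBl (mulrDl m%:~R) cosB cosD; ring.
Qed.

(* Multiplying by 2 sin(θ/2), θ = 2 pi m / n, makes the sum telescope. *)
Lemma sum_cos_multiples_eq0 (n m : nat) : (0 < m < n)%N ->
  \sum_(0 <= k < n) cos (m%:R * (2 * pi * k%:R / n%:R)) = 0 :> R.
Proof.
case/andP=> m_gt0 lt_mn.
have n_gt0 : 0 < n%:R :> R by rewrite ltr0n; exact: ltn_trans lt_mn.
have n_neq0 : n%:R != 0 :> R by rewrite gt_eqF.
pose t : R := pi * m%:R / n%:R.
(* Since 0 < m < n, the half-angle [t] lies strictly between 0 and pi, so the factor 2 sin t can be
   cancelled. *)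
have s_gt0 : 0 < sin t.
  apply: sin_gt0_pi; rewrite divr_gt0 // ?mulr_gt0 ?pi_gt0 ?ltr0n //=.
  by rewrite ltr_pdivrMr // ltr_pM2l ?pi_gt0 // ltr_nat.
have s_neq0 : 2 * sin t != 0 by rewrite mulf_neq0 ?pnatr_eq0 ?gt_eqF.
apply: (mulfI s_neq0).
rewrite mulr0 mulr_sumr.
pose g (k : nat) := sin (2 * t * k%:R - t).
transitivity (\sum_(0 <= k < n) (g k.+1 - g k)).
  apply: eq_bigr => k _; rewrite /g.
  have -> : m%:R * (2 * pi * k%:R / n%:R) = 2 * t * k%:R.
    by rewrite /t; field.
  have -> : 2 * t * k.+1%:R - t = 2 * t * k%:R + t by rewrite -natr1; ring.
  by rewrite sinD sinB; ring.
rewrite telescope_sumr // /g mulr0 sub0r.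
(* Over the whole range the angle makes [m] full turns, so the two end terms of the telescoped sum
   agree. *)
have -> : 2 * t * n%:R = (pi *+ 2) *+ m.
  by rewrite -[RHS]mulr_natr -mulr_natl /t; field.
by rewrite [_ *+ m + _]addrC (periodicn (@sinD2pi R)) subrr.
Qed.

Lemma sum_cos_multiples (n : nat) (m : int) : (`|m| < n)%N ->
  \sum_(0 <= k < n) cos (m%:~R * (2 * pi * k%:R / n%:R)) =
    n%:R * (m == 0)%:R :> R.
Proof.
have [->|m_neq0] := eqVneq m 0 => lt_mn.
  rewrite (eq_bigr (fun=> 1)) => [|k _]; last by rewrite mul0r cos0.
  by rewrite sumr_const_nat subn0 mulr1.
rewrite mulr0 -[RHS](@sum_cos_multiples_eq0 n `|m|%N) ?lt_mn ?absz_gt0 ?m_neq0 //.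
apply: eq_bigr => k _; case: m {m_neq0 lt_mn} => // j.
by rewrite NegzE mulrNz mulNr cosN.
Qed.

(** Reducing r(k+1) modulo n drops a multiple of n, which shifts the angle by a multiple of 2 pi. *)
Lemma omega_cos_sigma (n : nat) (r : int) (k : 'I_n.-1) :
  coprimez r n%:Z ->
  omega_cos R (sigma r k) = cos (r%:~R * (2 * pi * k.+1%:R / n%:R)).
Proof.
move=> co; have n_neq0 : n%:R != 0 :> R.
  by rewrite pnatr_eq0; move: (ltn_ord k); clear; case: n k.
have /(congr1 (fun z : int => z%:~R : R)) := divz_eq (r * k.+1%:Z) n%:Z.
rewrite -(sigmaE k co) rmorphD !rmorphM /= -!pmulrn => E.
rewrite /omega_cos -(cos_add_2piz _ (r * k.+1%:Z %/ n%:Z)%Z); congr cos.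
rewrite [RHS](_ : _ = 2 * pi / n%:R * (r%:~R * k.+1%:R)); last by field.
by rewrite E; field.
Qed.

(* Adding the term k = 0, which is 2 ^ (sum of the h_j) = size l, turns the
   pattern sum into a sum of full character sums; only the frequency 0
   survives once n exceeds all frequencies. *)
Lemma pattern_sum_eventually_affine (p : pattern) :
  exists (N : nat) (c d : rat), forall n : nat, (2 <= n)%N -> (N <= n)%N ->
    (forall j, coprimez (pr (p := p) j) n%:Z) ->
    mmap ratr (@omega_cos R n) (pattern_sum n p) = ratr (c * n%:R - d).
Proof.
(* Each multiplier r_j is repeated h_j times, turning the powers into a plain product of cosines. *)
pose s := flatten [seq nseq (ph (p := p) j) (pr j) | j <- index_enum 'I_(plen p).+1].
have [l Hl] := prod_cos_linearize s.
exists (\max_(m <- l) `|m|%N).+1, (count_mem 0 l)%:R, (size l)%:R.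
move=> n n_ge2 n_large co.
pose x (k : nat) : R := 2 * pi * k%:R / n%:R.
transitivity (\sum_(k < n.-1) \sum_(m <- l) cos (m%:~R * x k.+1)).
  rewrite raddf_sum; apply: eq_bigr => k _ /=.
  rewrite -Hl big_flatten big_map rmorph_prod; apply: eq_bigr => j _ /=.
  rewrite rmorphXn /= mmapZ mmapX mmap1U omega_cos_sigma // rmorph_nat.
  by rewrite big_nseq iter_mulr_1.
have -> : \sum_(k < n.-1) \sum_(m <- l) cos (m%:~R * x k.+1) =
          \sum_(0 <= k < n) \sum_(m <- l) cos (m%:~R * x k) - (size l)%:R.
  rewrite (big_ltn (ltnW n_ge2)) big_add1 big_mkord.
  rewrite [X in X + _ - _](_ : _ = (size l)%:R) 1?addrAC ?subrr ?add0r //.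
  rewrite (eq_bigr (fun=> 1)) => [|m _]; last by rewrite /x mulr0 mul0r mulr0 cos0.
  by rewrite big_const_seq count_predT iter_addr_0.
rewrite exchange_big /= rmorphB rmorphM /= !rmorph_nat; congr (_ - _).
(* [big_seq] records that m is in [l], whence |m| < n. *)
rewrite mulrC -sum1_count (big_mkcond (pred1 0)) natr_sum mulr_sumr big_seq [RHS]big_seq.
apply: eq_bigr => m m_in; rewrite sum_cos_multiples //.
by apply: leq_trans n_large; rewrite ltnS; apply: leq_bigmax_seq.
Qed.

End Cos.

Theorem theorem4p3 (R : realType) (F : forall n : nat, {mpoly rat[n.-1]})
    (n0 : int) (M : nat) (P : 'I_M -> pattern) (Psi : {mpoly rat[M]})
    (hF : uniformly_pattern_generated_by F n0 P Psi) :
  exists (n1 : int) (Rinf : {poly rat}),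
    forall n : nat, (2 <= n)%N -> n1 <= n%:Z -> pattern_coprime P n ->
      cos_value R F n = ratr Rinf.[n%:R].
Proof.
have /fin_all_exists[N /fin_all_exists[c /fin_all_exists[d Hcd]]] :=
  fun m => @pattern_sum_eventually_affine R (P m).
exists (Num.max n0 (\max_m N m)%:Z).
(* The witness is [Psi] with its m-th variable replaced by the affine polynomial [c m] X - [d m]. *)
exists (mmap polyC (fun m => (c m)%:P * 'X - (d m)%:P) Psi) => n n_ge2.
rewrite ge_max lez_nat => /andP[n0_le N_le] co.
rewrite /cos_value (hF n) // meval_map_mpoly mmap_comp_mpoly /mmap.
rewrite horner_sum rmorph_sum; apply: eq_bigr => m _ /=.
rewrite hornerCM rmorphM /= horner_prod rmorph_prod; congr (_ * _).
apply: eq_bigr => i _; rewrite tnth_mktuple horner_exp rmorphXn /= !hornerE.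
congr (_ ^+ _); apply: Hcd => //; last exact: pattern_coprimeP.
exact: leq_trans (leq_bigmax i) N_le.
Qed.
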